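(* For every integer $d\ge 4$, the $3$-uniform cube hypergraph $Q^3_d$ is loose Hamilton connected: for any two distinct vertices $a,b$ of $Q^3_d$ there exists a loose path from $a$ to $b$ whose vertex set is the whole vertex set $\{0,1,2\}^d$.
   Context: For $d\in\mathbb{N}_0$, the cube hypergraph $Q^3_d$ is the $3$-uniform hypergraph with vertex set $V_d=\{0,1,2\}^d$ (sequences of length $d$ with entries in $\{0,1,2\}$), whose edges are all unordered triples $\{a,b,c\}$ of pairwise distinct sequences that agree in $d-1$ coordinates (so in the remaining coordinate they take the values $0,1,2$ in some order). A loose path of length $\ell$ from $v_0$ to $v_{2\ell}$ consists of distinct vertices $v_0,v_1,\dots,v_{2\ell}$ and distinct edges $e_1,\dots,e_\ell$ with $e_i=\{v_{2i-2},v_{2i-1},v_{2i}\}$ for $i=1,\dots,\ell$. A hypergraph is loose Hamilton connected if for any two distinct vertices $a,b$ there is a loose path from $a$ to $b$ containing all vertices. *)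

(* Defs.v *)
From mathcomp Require Import all_boot.
Set Implicit Arguments. Unset Strict Implicit. Unset Printing Implicit Defensive.

Definition cube_vertex (d : nat) := {ffun 'I_d -> 'I_3}.

Definition cube_edge (d : nat) (e : {set cube_vertex d}) : bool :=
  (#|e| == 3) &&
  [exists i : 'I_d, [forall a in e, forall b in e, forall j : 'I_d,
      (j != i) ==> (a j == b j)]].

(* The i-th edge (i = 1..l) of the vertex sequence v_0 ... v_{2l}. *)
Definition path_edge (d : nat) (v : seq (cube_vertex d)) (x0 : cube_vertex d)
  (i : nat) : {set cube_vertex d} :=
  [set nth x0 v (2 * i - 2); nth x0 v (2 * i - 1); nth x0 v (2 * i)].

Definition loose_path (d : nat) (l : nat) (v : seq (cube_vertex d))
  (a b : cube_vertex d) : Prop :=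
  [/\ size v = (2 * l).+1, uniq v,
      head a v = a /\ last a v = b,
      (forall i, 1 <= i <= l -> cube_edge (path_edge v a i)) &
      (forall i j, 1 <= i <= l -> 1 <= j <= l -> i != j ->
         path_edge v a i != path_edge v a j)].

Definition loose_hamilton_connected (d : nat) : Prop :=
  forall a b : cube_vertex d, a != b ->
    exists (l : nat) (v : seq (cube_vertex d)),
      loose_path l v a b /\ (forall x : cube_vertex d, x \in v).

(* Main.v *)
Require Import Defs.
From mathcomp Require Import all_boot.
From mathcomp Require Import fingroup perm zify.
Set Implicit Arguments. Unset Strict Implicit. Unset Printing Implicit Defensive.

(** Induction on the dimension.  Call two lines {o,s,t} and {o,x,y} crossing at o a
    cross; the induction carries, besides Hamilton connectedness, the statement that
    every cross admits a Hamilton path s ... o x y ... t ending at s and t and using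
    the edge {o,x,y} with middle vertex x.

    Split the next cube into layers A, B, C.  Let (u1,u4,u2), (u2,u3,u5) be two
    consecutive edges of a path in A.  They form a cross, which gives Hamilton paths
    u1 ... u2 u5 u3 ... u4 of B and u3 ... u2 u1 u4 ... u5 of C.  Removing their edges
    {u2,u5,u3} and {u2,u1,u4}, the remaining pieces can be joined by the vertical edges
    over u1, u2, u3, u4, u5 into

      A..u1 (Cu1) Bu1..Bu2 (Au2) Cu2..Cu3 (Au3) Bu3..Bu4 (Au4) Cu4..Cu5 (Bu5) Au5..A

    so the two edges are replaced by a path absorbing B and C entirely.  If u5 is the
    end of the path in A, finishing with Cu5 (Au5) Bu5 instead moves the end to B.  Two
    vertices that differ only in the split coordinate are on a cross.  Dimension 4 is
    settled by explicit paths, one for each orbit of the symmetry group. *)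

(** * Lines of the cube and paths made of lines *)

Section Line.
Variable d : nat.
Implicit Types a b u v w x y z : cube_vertex d.

Definition line u v w :=
  [exists i, [&& u i != v i, u i != w i, v i != w i &
    [forall j, (j != i) ==> (u j == v j) && (u j == w j)]]].

Lemma lineP u v w : reflect
  (exists i, [/\ u i != v i, u i != w i, v i != w i &
     forall j, j != i -> u j = v j /\ u j = w j]) (line u v w).
Proof.
apply: (iffP existsP) => -[i].
  case/and4P=> h1 h2 h3 /forallP h4; exists i; split=> // j ji.
  by have /implyP/(_ ji)/andP[/eqP-> /eqP->] := h4 j.
case=> h1 h2 h3 h4; exists i; rewrite h1 h2 h3 /=.
by apply/forallP=> j; apply/implyP=> /h4 [<- <-]; rewrite eqxx.
Qed.

Lemma lineC u v w : line u v w -> line v u w.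
Proof.
case/lineP=> i [h1 h2 h3 h4]; apply/lineP; exists i; split; rewrite // 1?eq_sym //.
by move=> j /h4 [-> <-].
Qed.

Lemma lineCr u v w : line u v w -> line u w v.
Proof.
case/lineP=> i [h1 h2 h3 h4]; apply/lineP; exists i; split; rewrite // 1?eq_sym //.
by move=> j /h4 [].
Qed.

Lemma line_rot u v w : line u v w -> line v w u.
Proof. by move/lineC/lineCr. Qed.

Lemma line_rev u v w : line u v w -> line w v u.
Proof. by move/line_rot/lineC. Qed.

Lemma line_neq u v w : line u v w -> [/\ u != v, u != w & v != w].
Proof.
by case/lineP=> i [h1 h2 h3 _]; split; apply/eqP=> e;
  [move: h1|move: h2|move: h3]; rewrite e eqxx.
Qed.

Lemma line_edge u v w : line u v w -> cube_edge [set u; v; w].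
Proof.
move=> l; have [uv uw vw] := line_neq l.
rewrite /cube_edge -setUA cardsU1 cards2 vw !inE negb_or uv uw /=.
have [i [_ _ _ h]] := lineP _ _ _ l; apply/existsP; exists i.
apply/forallP=> a; apply/implyP=> ha; apply/forallP=> b; apply/implyP=> hb.
apply/forallP=> j; apply/implyP=> /h [h1 h2].
suff e c : c \in u |: [set v; w] -> c j = u j by rewrite !e.
by rewrite !inE => /or3P[] /eqP->.
Qed.

(** Nothing here forces the vertices to be distinct; that comes from comparing the sequence with the
    enumeration of the cube by [perm_eq]. *)
Inductive lpath : cube_vertex d -> cube_vertex d -> seq (cube_vertex d) -> Prop :=
| LPath0 x : lpath x x [:: x]
| LPathS x m y z s : line x m y -> lpath y z s -> lpath x z (x :: m :: s).

Lemma lpath_cat x y m z w s t :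
  lpath x y s -> line y m z -> lpath z w t -> lpath x w (s ++ m :: t).
Proof.
move=> h; elim: h m z t => {x y s} [x|x m' y y' s l _ IH] m z t lm ht /=.
  exact: LPathS lm ht.
by apply: LPathS l _; apply: IH lm ht.
Qed.

Lemma lpath_rev x y s : lpath x y s -> lpath y x (rev s).
Proof.
elim=> {x y s} [x|x m y z s l _ IH]; first exact: LPath0.
rewrite -[_ :: _ :: _]/([:: x; m] ++ s) rev_cat /=.
exact: lpath_cat IH (line_rev l) (LPath0 x).
Qed.

Lemma lpath_head x y s : lpath x y s -> exists t, s = x :: t.
Proof. by case=> [z|z m y' w t _ _]; eexists. Qed.

Lemma lpath_last x y s x0 : lpath x y s -> last x0 s = y.
Proof. by move=> h; elim: h x0 => {x y s} //= x m y z s _ _ IH _; apply: IH. Qed.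

Lemma lpath_odd x y s : lpath x y s -> odd (size s).
Proof. by elim=> //= {x y s} x m y z s _ _; rewrite negbK. Qed.

Lemma lpath_long x y s : lpath x y s -> 4 < size s ->
  exists u1 u4 u2 u3 u5 t, [/\ u1 = x, line u1 u4 u2, line u2 u3 u5,
    lpath u5 y t & s = [:: u1, u4, u2, u3 & t]].
Proof.
case=> {x y s} [//|x m y w t + h]; case: h => {y w t} [//|u m' v w t l2 h l1 _].
by exists x, m, u, m', v, t.
Qed.

End Line.

(** * The two statements carried by the induction *)

Definition ham_connected d := forall a b : cube_vertex d, a != b ->
  exists2 s, lpath a b s & perm_eq s (enum {: cube_vertex d}).

(** The path is stored with the edge through [o], [x], [y] already removed: weaving needs the two
    pieces, while [x] remains as a single vertex. *)
Definition cross_path d (o s t x y : cube_vertex d) := exists p q,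
  [/\ lpath s o p, lpath y t q & perm_eq (p ++ x :: q) (enum {: cube_vertex d})].

Definition cross_connected d := forall o s t x y : cube_vertex d,
  line o s t -> line o x y -> s != x -> s != y -> cross_path o s t x y.

Lemma uniq_full_perm (T : finType) (s : seq T) :
  uniq s -> size s = #|T| -> perm_eq s (enum T).
Proof.
move=> us zs; apply: uniq_perm (enum_uniq _) _ => // x.
rewrite mem_enum inE.
have /subset_cardP h : #|s| = #|T| by rewrite (card_uniqP us).
by have /h-> : s \subset T by apply/subsetP.
Qed.

(** Rearrangements of vertex sequences are checked by counting an arbitrary predicate on both sides:
    each count becomes an unknown, and the claim is linear arithmetic. *)
Ltac count_lia :=
  rewrite /image_mem; repeat progress rewrite ?(map_cat, map_rev, count_cat, count_rev) /=;
  repeat match goal with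
  | |- context [count ?P ?s] => move: (count P s) => ?
  | |- context [nat_of_bool ?b] => move: (nat_of_bool b) => ?
  end; clear; lia.

(** * Layers of the next cube and weaving through them *)

Lemma third_layer (A B : 'I_3) : A != B -> exists2 C, A != C & B != C.
Proof.
move=> AB; have /card_gt0P[C] : 0 < #|~: [set A; B]| by rewrite cardsCs setCK card_ord cards2 AB.
by rewrite !inE negb_or ![C == _]eq_sym => /andP[]; exists C.
Qed.

Lemma other_layers (A : 'I_3) : exists B C, [/\ A != B, A != C & B != C].
Proof.
have h : A != ordS A by case: A => [[|[|[|]]]].
have [C h1 h2] := third_layer h.
by exists (ordS A), C.
Qed.

Section Layer.
Variable d : nat.
Implicit Types u v w : cube_vertex d.

Definition layer (c : 'I_3) v : cube_vertex d.+1 :=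
  [ffun i => oapp v c (unlift ord0 i)].

Lemma layer0 c v : layer c v ord0 = c.
Proof. by rewrite ffunE unlift_none. Qed.

Lemma layerS c v i : layer c v (lift ord0 i) = v i.
Proof. by rewrite ffunE liftK. Qed.

Lemma layer_surj (x : cube_vertex d.+1) : exists c v, x = layer c v.
Proof.
exists (x ord0), [ffun i => x (lift ord0 i)]; apply/ffunP=> i.
by case: (unliftP ord0 i) => [j|] ->; rewrite ?layerS ?layer0 ?ffunE.
Qed.

Lemma layer_inj c : injective (layer c).
Proof. by move=> u v e; apply/ffunP=> i; rewrite -!(layerS c) e. Qed.

Lemma line_layer c u v w : line u v w -> line (layer c u) (layer c v) (layer c w).
Proof.
case/lineP=> i [h1 h2 h3 h]; apply/lineP; exists (lift ord0 i).
rewrite !layerS; split=> // j.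
case: (unliftP ord0 j) => [k|] ->; rewrite ?layerS ?layer0 // => ki.
by apply: h; apply: contra ki => /eqP->.
Qed.

Lemma lpath_layer c u v s : lpath u v s -> lpath (layer c u) (layer c v) (map (layer c) s).
Proof.
elim=> {u v s} [u|u m v w s l _ IH]; first exact: LPath0.
exact: LPathS (line_layer c l) IH.
Qed.

Lemma line_vertical A B C v : A != B -> A != C -> B != C ->
  line (layer A v) (layer B v) (layer C v).
Proof.
move=> AB AC BC; apply/lineP; exists ord0; rewrite !layer0; split=> // j.
by case: (unliftP ord0 j) => [k|] -> //; rewrite !layerS.
Qed.

Lemma perm_layers A B C : A != B -> A != C -> B != C ->
  perm_eq ([seq layer A v | v : cube_vertex d] ++ [seq layer B v | v : cube_vertex d]
    ++ [seq layer C v | v : cube_vertex d]) (enum {: cube_vertex d.+1}).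
Proof.
move=> AB AC BC; apply: uniq_full_perm.
  have dis c c' : c != c' ->
      has (mem [seq layer c v | v : cube_vertex d]) [seq layer c' v | v : cube_vertex d] = false.
    move=> cc'; apply/hasPn=> _ /mapP[v _ ->]; apply: contra cc' => /mapP[u _ e].
    by rewrite -(layer0 c u) -e layer0.
  have un c : uniq [seq layer c v | v : cube_vertex d].
    by rewrite map_inj_uniq ?enum_uniq //; apply: layer_inj.
  by rewrite !cat_uniq has_cat !dis // !un.
by rewrite !size_cat !size_image !card_ffun !card_ord expnS; lia.
Qed.

(* [C u1] and [B u5] are left over as middle vertices of the vertical edges entering
   and leaving the woven path. *)
Lemma weave (A B C : 'I_3) u1 u2 u3 u4 u5 : cross_connected d ->
  A != B -> A != C -> B != C ->
  line u1 u4 u2 -> line u2 u3 u5 -> uniq [:: u1; u4; u2; u3; u5] ->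
  exists2 r, lpath (layer B u1) (layer C u5) r &
    perm_eq [:: layer C u1, layer B u5 & r]
     ([:: layer A u4; layer A u2; layer A u3] ++
      [seq layer B v | v : cube_vertex d] ++ [seq layer C v | v : cube_vertex d]).
Proof.
move=> G AB AC BC l1 l2.
rewrite /= !inE !negb_or => /and5P[/and4P[_ _ n13 n15] /and3P[_ n43 _] _ _ _].
have lB1 : line u2 u1 u4 by apply: line_rot; apply: line_rot.
have lB2 : line u2 u5 u3 by apply: lineCr.
(* Both crosses have centre [u2], with the two lines exchanged: [B1], [B2] run from [u1] to [u2] and
   from [u3] to [u4], while [C1], [C2] run from [u3] to [u2] and from [u4] to [u5]. *)
have [B1 [B2 [hB1 hB2 pB]]] := G _ _ _ _ _ lB1 lB2 n15 n13.
have [C1 [C2 [hC1 hC2 pC]]] : cross_path u2 u3 u5 u1 u4.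
  by apply: G; rewrite // eq_sym.
exists (map (layer B) B1 ++ layer A u2 :: map (layer C) (rev C1) ++ layer A u3 ::
  map (layer B) B2 ++ layer A u4 :: map (layer C) C2).
  have [BA CA CB] : [/\ B != A, C != A & C != B] by split; rewrite eq_sym.
  apply: (lpath_cat (lpath_layer B hB1) (line_vertical u2 BA BC AC)).
  apply: (lpath_cat (lpath_layer C (lpath_rev hC1)) (line_vertical u3 CA CB AB)).
  apply: (lpath_cat (lpath_layer B hB2) (line_vertical u4 BA BC AC)).
  exact: lpath_layer.
apply/seq.permP=> P.
have /seq.permP/(_ P) := perm_map (layer B) pB.
have /seq.permP/(_ P) := perm_map (layer C) pC.
count_lia.
Qed.

(* The vertices [q] stay untouched, so that an edge elsewhere can be protected. *)
Lemma extend_lpath (A : 'I_3) a b p q : cross_connected d ->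
  lpath a b p -> 4 < size p -> perm_eq (p ++ q) (enum {: cube_vertex d}) ->
  exists2 r, lpath (layer A a) (layer A b) r &
    perm_eq (r ++ map (layer A) q) (enum {: cube_vertex d.+1}).
Proof.
move=> G hp zp pp.
have up : uniq p.
  by have := perm_uniq pp; rewrite enum_uniq cat_uniq => /andP[].
have [B [C [AB AC BC]]] := other_layers A.
have [u1 [u4 [u2 [u3 [u5 [t [e1 l1 l2 ht ep]]]]]]] := lpath_long hp zp.
have [t' et] := lpath_head ht.
have uu : uniq [:: u1; u4; u2; u3; u5].
  by apply: subseq_uniq up; rewrite ep et; apply: (prefix_subseq _ t').
have [r hr pr] := weave G AB AC BC l1 l2 uu.
subst u1; exists ((layer A a :: layer C a :: r) ++ layer B u5 :: map (layer A) t).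
  have [BA CA CB] : [/\ B != A, C != A & C != B] by split; rewrite eq_sym.
  apply: lpath_cat (line_vertical u5 CB CA BA) (lpath_layer A ht).
  exact: LPathS (line_vertical a AC AB CB) hr.
apply: perm_trans (perm_layers AB AC BC); apply/seq.permP=> P.
have /seq.permP/(_ P) := perm_map (layer A) pp.
move/seq.permP/(_ P): pr; rewrite ep.
count_lia.
Qed.

End Layer.

(** With at least 27 vertices, one of the two pieces has more than four, hence two consecutive
    edges. That piece absorbs the other layers, while the other piece and [x] are protected. *)
Lemma cross_path_layer d (o s t x y : cube_vertex d) : 2 < d -> cross_connected d ->
  cross_path o s t x y ->
  cross_path (layer ord0 o) (layer ord0 s) (layer ord0 t) (layer ord0 x) (layer ord0 y).
Proof.
move=> d2 G [p [q [hp hq pr]]].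
have zpq : 8 < size p + size q.
  have : 27 <= 3 ^ d by rewrite (@leq_exp2l 3 3).
  have := perm_size pr; rewrite size_cat /= -cardE card_ffun !card_ord => <-.
  by move: (size p) (size q); lia.
have [zp|zq] : 4 < size p \/ 4 < size q by lia.
  have [r hr pr'] := extend_lpath ord0 G hp zp pr.
  by exists r, (map (layer ord0) q); split=> //; apply: lpath_layer.
have pr2 : perm_eq (q ++ x :: p) (enum {: cube_vertex d}).
  by apply: perm_trans pr; apply/seq.permP=> P; count_lia.
have [r hr pr'] := extend_lpath ord0 G hq zq pr2.
exists (map (layer ord0) p), r; split=> //; first exact: lpath_layer.
by apply: perm_trans pr'; apply/seq.permP=> P; count_lia.
Qed.

Lemma layer_neq d (c c' : 'I_3) (u v : cube_vertex d) :
  layer c u != layer c' v -> (c != c') || (u != v).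
Proof. by apply: contraR; rewrite negb_or !negbK => /andP[/eqP-> /eqP->]. Qed.

(** * Symmetries of the cube *)

Section Automorphism.
Variables (d : nat) (pi : {perm 'I_d}) (sigma : 'I_d -> 'I_3 -> 'I_3).
Hypothesis sigma_inj : forall k, injective (sigma k).

Definition cube_aut (v : cube_vertex d) : cube_vertex d :=
  [ffun k => sigma k (v (pi k))].

Lemma cube_aut_inj : injective cube_aut.
Proof.
move=> u v /ffunP e; apply/ffunP=> k; apply: (@sigma_inj ((pi^-1)%g k)).
by have := e ((pi^-1)%g k); rewrite !ffunE permKV.
Qed.

Lemma line_aut u v w : line u v w -> line (cube_aut u) (cube_aut v) (cube_aut w).
Proof.
case/lineP=> i [h1 h2 h3 h]; apply/lineP; exists ((pi^-1)%g i).
rewrite !ffunE !permKV !(inj_eq (@sigma_inj _)); split=> // j ji.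
rewrite !ffunE; suff [-> ->] : u (pi j) = v (pi j) /\ u (pi j) = w (pi j) by [].
by apply: h; apply: contra ji => /eqP <-; rewrite permK.
Qed.

Lemma lpath_aut a b s : lpath a b s -> lpath (cube_aut a) (cube_aut b) (map cube_aut s).
Proof.
elim=> {a b s} [a|a m b c s l _ IH]; first exact: LPath0.
exact: LPathS (line_aut l) IH.
Qed.

Lemma perm_aut s : perm_eq s (enum {: cube_vertex d}) ->
  perm_eq (map cube_aut s) (enum {: cube_vertex d}).
Proof.
move=> ps; apply: uniq_full_perm.
  by rewrite (map_inj_uniq cube_aut_inj) (perm_uniq ps) enum_uniq.
by rewrite size_map (perm_size ps) -cardE.
Qed.

Lemma cross_path_aut o s t x y : cross_path o s t x y ->
  cross_path (cube_aut o) (cube_aut s) (cube_aut t) (cube_aut x) (cube_aut y).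
Proof.
case=> p [q [hp hq pr]]; exists (map cube_aut p), (map cube_aut q).
by split; rewrite -1?map_cons -?map_cat; [apply: lpath_aut..|apply: perm_aut].
Qed.
End Automorphism.

Lemma ord3_eq (a b c e : 'I_3) : a != b -> a != c -> a != e -> c != e -> b != c -> b = e.
Proof.
case: a b c e => [a la] [b lb] [c lc] [e le]; rewrite -!val_eqE /= => *.
by apply: val_inj => /=; lia.
Qed.

Lemma perm_two d (i0 j0 i j : 'I_d) : i0 != j0 -> i != j ->
  exists pi : {perm 'I_d}, pi i = i0 /\ pi j = j0.
Proof.
(* [k] is where the swap of [i] and [i0] sends [j]; a second swap takes [k] to [j0] and fixes
   [i0]. *)
move=> n0 n; set k := tperm i i0 j; have ki : k != i0.
  by rewrite -[i0](tpermL i i0) (inj_eq perm_inj) eq_sym.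
exists (tperm i i0 * tperm k j0)%g; rewrite !permM tpermL -/k tpermL tpermD //.
by rewrite eq_sym.
Qed.

(* The configurations of [cross_connected] form a single orbit. *)
Lemma cross_orbit d (i0 j0 : 'I_d) (o0 s0 t0 x0 y0 : cube_vertex d) :
  i0 != j0 -> o0 = [ffun=> ord0] ->
  s0 = [ffun k => if k == i0 then inord 1 else ord0] ->
  t0 = [ffun k => if k == i0 then inord 2 else ord0] ->
  x0 = [ffun k => if k == j0 then inord 1 else ord0] ->
  y0 = [ffun k => if k == j0 then inord 2 else ord0] ->
  cross_path o0 s0 t0 x0 y0 -> cross_connected d.
Proof.
move=> n0 -> -> -> -> -> cp o s t x y /lineP[i [os ot st h]] /lineP[j [ox oy xy h']] sx sy.
have n : i != j.
  (* A line is determined by a vertex and its direction, so equal directions would make [s] one of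
     [x], [y]. *)
  apply/eqP=> e; subst j; have : (s == x) || (s == y).
    have [e|ne] := eqVneq (s i) (x i); [apply/orP; left|apply/orP; right]; apply/eqP/ffunP=> k.
      by have [->//|ki] := eqVneq k i; have [<- _] := h _ ki; have [<- _] := h' _ ki.
    have [->|ki] := eqVneq k i; last by have [<- _] := h _ ki; have [_ <-] := h' _ ki.
    exact: ord3_eq os ox oy xy ne.
  by rewrite (negPf sx) (negPf sy).
have [pi [pi_i pi_j]] := perm_two n0 n.
pose trip u v w (c : 'I_3) : 'I_3 := if val c is c'.+1 then if c' is 0 then v else w else u.
have trip_inj u v w : u != v -> u != w -> v != w -> injective (trip u v w).
  move=> uv uw vw [a la] [b lb]; rewrite /trip /= => e; apply: val_inj => /=.
  move: a b la lb e => [|[|[|a]]] // [|[|[|b]]] // _ _ e; move: uv uw vw;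
    by rewrite e eqxx.
(* In the two directions of the cross all three values are prescribed; elsewhere only 0 has to go to
   the common entry [o k]. *)
pose sigma k := if k == i then trip (o i) (s i) (t i) else
  if k == j then trip (o j) (x j) (y j) else tperm ord0 (o k).
have sinj k : injective (sigma k).
  rewrite /sigma; case: eqP => _; first exact: trip_inj.
  by case: eqP => _; [apply: trip_inj|apply: perm_inj].
have pk k : ((pi k == i0) = (k == i)) * ((pi k == j0) = (k == j)).
  by rewrite -pi_i -pi_j !(inj_eq perm_inj).
have := cross_path_aut pi sinj cp.
have val1 : val (inord 1 : 'I_3) = 1 by rewrite /= inordK.
have val2 : val (inord 2 : 'I_3) = 2 by rewrite /= inordK.
congr (cross_path _ _ _ _ _); apply/ffunP=> k; rewrite !ffunE ?pk /sigma;
  (have [ki|ki] := eqVneq k i; [subst k|]; [|have [kj|kj] := eqVneq k j; [subst k|]]);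
  rewrite ?(negPf n) /trip ?val1 ?val2 /= ?tpermL //;
  by [have [] := h _ ki | have [] := h' _ kj | have [] := h' _ n | have [] := h _ ki | rewrite ?eqxx].
Qed.

(** * The induction step *)

Lemma line_cross d (o a b : cube_vertex d) : 1 < d -> line o a b ->
  exists x y, [/\ line o x y, a != x & a != y].
Proof.
move=> d1 /lineP[i [_ _ _ h]].
have /card_gt0P[j] : 0 < #|~: [set i]| by rewrite cardsC1 card_ord; lia.
rewrite !inE => ji; have [aj _] := h _ ji.
have [B [C [oB oC BC]]] := other_layers (o j).
pose upd c : cube_vertex d := [ffun k => if k == j then c else o k].
have ne c : o j != c -> a != upd c.
  by apply: contra => /eqP ac; rewrite aj ac ffunE eqxx.
exists (upd B), (upd C); split; rewrite ?ne //.
apply/lineP; exists j; rewrite !ffunE eqxx; split=> // k kj.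
by rewrite !ffunE (negPf kj).
Qed.

(** The line is completed to a cross at its third vertex [o]; putting the edge through [o], [x], [y]
    back joins the two pieces. *)
Lemma adjacent_ham d (o a b : cube_vertex d) : 1 < d -> cross_connected d ->
  line o a b -> exists2 s, lpath a b s & perm_eq s (enum {: cube_vertex d}).
Proof.
move=> d1 G l; have [x [y [l' ax ay]]] := line_cross d1 l.
have [p [q [hp hq pr]]] := G _ _ _ _ _ l l' ax ay.
by exists (p ++ x :: q); first exact: lpath_cat hp l' hq.
Qed.

(** Three cases: the ends differ only in the split coordinate and lie on a line, or they share a
    layer and a path there is extended, or they differ in both respects and the end of the path
    moves to another layer. *)
Lemma ham_connectedS d : 2 < d -> cross_connected d -> cross_connected d.+1 ->
  ham_connected d -> ham_connected d.+1.
Proof.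
move=> d2 G G' H a b.
have [A [u ->]] := layer_surj a; have [B [v ->]] := layer_surj b => ne.
have long s : perm_eq s (enum {: cube_vertex d}) -> 4 < size s.
  move/perm_size->; rewrite -cardE card_ffun !card_ord.
  by apply: (@leq_trans (3 ^ 2)); rewrite ?leq_exp2l; lia.
have [uv|uv] := eqVneq u v.
  have AB : A != B by move/layer_neq: ne; rewrite uv eqxx orbF.
  have [C AC BC] := third_layer AB.
  rewrite uv; apply: (@adjacent_ham _ (layer C v)) => //; first by lia.
  by apply: line_vertical; rewrite // eq_sym.
have [AB|AB] := eqVneq A B.
  have [s hs ps] := H _ _ uv; rewrite -AB.
  have := @extend_lpath d A u v s [::] G hs (long _ ps).
  by rewrite cats0 => /(_ ps)[r hr]; rewrite cats0; exists r.
have [C AC BC] := third_layer AB.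
(* The path is read from [v], so that its first two edges, which get replaced, lie at the end that
   moves from layer [A] to layer [B]. *)
rewrite eq_sym in uv; have [s hs ps] := H _ _ uv.
have [u5 [u3 [u2 [u4 [u1 [t [e l2 l1 ht es]]]]]]] := lpath_long hs (long _ ps); subst u5.
have [t' et] := lpath_head ht.
have uu : uniq [:: u1; u4; u2; u3; v].
  have us : uniq s by rewrite (perm_uniq ps) enum_uniq.
  by rewrite -rev_uniq; apply: subseq_uniq us; rewrite es et; apply: (prefix_subseq _ t').
have [r hr pr] := weave G AB AC BC (line_rev l1) (line_rev l2) uu.
have [BA CA CB] : [/\ B != A, C != A & C != B] by split; rewrite eq_sym.
exists (map (layer A) (rev t) ++ layer C u1 :: r ++ layer A v :: [:: layer B v]).
  apply: (lpath_cat (lpath_layer A (lpath_rev ht)) (line_vertical u1 AC AB CB)).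
  exact: lpath_cat hr (line_vertical v CA CB AB) (LPath0 _).
apply: perm_trans (perm_layers d AB AC BC); apply/seq.permP=> P.
have /seq.permP/(_ P) := perm_map (layer A) ps.
move/seq.permP/(_ P): pr; rewrite es.
count_lia.
Qed.

(** As crosses form one orbit, a single instance in the larger cube suffices: the standard cross on
    the first and last coordinate, placed in layer 0. *)
Lemma cross_connectedS d : 2 < d -> cross_connected d -> cross_connected d.+1.
Proof.
case: d => [|[|d]] // d2 G; set D := d.+2 in d2 G *.
pose i0 : 'I_D := ord0; pose j0 : 'I_D := ord_max.
pose e (i : 'I_D) c : cube_vertex D := [ffun k => if k == i then c else ord0].
have ij : i0 != j0 by [].
have lin (i : 'I_D) : line [ffun=> ord0] (e i (inord 1)) (e i (inord 2)).
  apply/lineP; exists i; rewrite !ffunE eqxx -!val_eqE /= !inordK //; split=> // k ki.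
  by rewrite !ffunE (negPf ki).
have ne c : inord 1 != e j0 c i0 by rewrite ffunE (negPf ij) -val_eqE /= inordK.
have ne' c : e i0 (inord 1) != e j0 c.
  by apply: contra (ne c) => /eqP <-; rewrite ffunE eqxx.
have cp := cross_path_layer d2 G (G _ _ _ _ _ (lin i0) (lin j0) (ne' _) (ne' _)).
have lift_e i c : layer ord0 (e i c) = [ffun k => if k == lift ord0 i then c else ord0].
  apply/ffunP=> k; case: (unliftP ord0 k) => [k'|] ->; last first.
    by rewrite layer0 ffunE (negPf (neq_lift _ _)).
  by rewrite layerS !ffunE (inj_eq lift_inj).
apply: cross_orbit cp; rewrite ?(inj_eq lift_inj); try exact: lift_e; first exact: ij.
apply/ffunP=> k; case: (unliftP ord0 k) => [k'|] ->; by rewrite ?layerS ?layer0 !ffunE.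
Qed.

(** * Dimension 4: reduction to Hamming distances and explicit paths *)

Lemma perm_bool (s t : seq bool) : size s = size t -> count id s = count id t ->
  perm_eq s t.
Proof.
move=> zst cst; apply/seq.permP=> P.
have cE r : count P r = P true * count id r + P false * (size r - count id r).
  elim: r => [|b r IH] /=; first by rewrite !muln0.
  have := count_size id r; rewrite IH; case: b => h; rewrite /= ?add1n ?add0n.
    by rewrite subSS mulnS addnA.
  by rewrite subSn // mulnS addnCA.
by rewrite !cE zst cst.
Qed.

Lemma count_ltn_iota r d : count (fun k => k < r) (iota 0 d) = minn r d.
Proof.
elim: d => [|d IH]; first by rewrite minn0.
by rewrite -addn1 iotaD count_cat IH /=; case: (ltnP d r); lia.
Qed.

(* Up to symmetry, a pair of vertices is determined by its Hamming distance. *)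
Lemma ham_orbit d (a b : cube_vertex d) :
  let r := #|[pred k | a k != b k]| in
  (exists2 s, lpath [ffun=> ord0] [ffun k : 'I_d => if k < r then inord 1 else ord0] s
     & perm_eq s (enum {: cube_vertex d})) ->
  exists2 s, lpath a b s & perm_eq s (enum {: cube_vertex d}).
Proof.
move=> r [s hs ps].
have rd : r <= d by rewrite -[d in _ <= d]card_ord max_card.
(* [pi] moves the coordinates in which [a] and [b] differ to the first [r] places. *)
have /tuple_permP[pi epi] : perm_eq [tuple a k != b k | k < d] [tuple (k < r : bool) | k < d].
  apply: perm_bool; first by rewrite !size_tuple.
  rewrite /= !count_map.
  transitivity r.
    by rewrite /r cardE /enum_mem size_filter; apply: eq_count.
  transitivity (count (fun k => k < r) (map val (enum 'I_d))); last by rewrite count_map enumT.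
  by rewrite val_enum_ord count_ltn_iota; symmetry; apply/minn_idPl.
have ab k : (pi k < r) = (a k != b k).
  have := congr1 (fun t => nth false t k) epi.
  by rewrite -!tnth_nth !tnth_mktuple.
(* The first swap sends 0 to [a k]. If [b k] is different, the second corrects the image of 1 to
   [b k], and it fixes [a k]. *)
pose sg k : {perm 'I_3} := (tperm ord0 (a k) *
  (if a k == b k then 1 else tperm (tperm ord0 (a k) (inord 1)) (b k)))%g.
have sg0 k : sg k ord0 = a k.
  have w : tperm ord0 (a k) (inord 1) != a k.
    rewrite -[X in _ != X](tpermL ord0 (a k)) (inj_eq perm_inj).
    by rewrite -val_eqE /= inordK.
  rewrite permM tpermL; have [e|ne] := eqVneq (a k) (b k); first by rewrite perm1.
  by rewrite (tpermD w) // eq_sym.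
have sg1 k : a k != b k -> sg k (inord 1) = b k.
  by move=> ne; rewrite permM (negPf ne) tpermL.
have sinj k : injective (sg k) by apply: perm_inj.
have := lpath_aut pi sinj hs; have := perm_aut pi sinj ps; set s' := map _ _ => ps' hs'.
exists s' => //; move: hs'; congr (lpath _ _ _); apply/ffunP=> k; rewrite !ffunE //.
rewrite ab; case: eqVneq => [<-|ne]; first exact: sg0.
exact: sg1.
Qed.

(* The vertices of dimension 4 are coded by their base 3 expansion, least digit first. *)
Definition digit (n i : nat) := n %/ 3 ^ i %% 3.

Definition vertex4 (n : nat) : cube_vertex 4 := [ffun i : 'I_4 => inord (digit n i)].

Definition code_line (u v w : nat) := has (fun i =>
  [&& digit u i != digit v i, digit u i != digit w i, digit v i != digit w i &
    all (fun j => (j != i) ==> (digit u j == digit v j) && (digit u j == digit w j))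
      (iota 0 4)]) (iota 0 4).

Fixpoint code_path (s : seq nat) := match s with
  | [:: u, v & (w :: _) as t] => code_line u v w && code_path t
  | [:: _] => true
  | _ => false
  end.

Definition code_ham (s : seq nat) := perm_eq s (iota 0 81).

Lemma val_vertex4 n (i : 'I_4) : val (vertex4 n i) = digit n i.
Proof. by rewrite ffunE /= inordK // ltn_pmod. Qed.

Lemma line_code u v w : code_line u v w -> line (vertex4 u) (vertex4 v) (vertex4 w).
Proof.
case/hasP=> i; rewrite mem_iota => /andP[_ i4] /and4P[h1 h2 h3 /allP h].
apply/lineP; exists (Ordinal i4); split; rewrite -?val_eqE ?val_vertex4 // => j ji.
have : j != i :> nat by [].
have /h/implyP h4 : val j \in iota 0 4 by rewrite mem_iota ltn_ord.
by case/h4/andP=> /eqP h5 /eqP h6; split; apply: val_inj; rewrite !val_vertex4.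
Qed.

Lemma lpath_code s : code_path s ->
  lpath (vertex4 (head 0 s)) (vertex4 (last 0 s)) (map vertex4 s).
Proof.
(* Strong induction on the size, as each edge consumes two entries. *)
have [n] := ubnP (size s); elim: n s => // n IH [//|u [_ _|v [//|w s]]]; first exact: LPath0.
move=> sn /andP[l h]; apply: LPathS (line_code l) (IH (w :: s) _ h).
by move: sn; rewrite /= !ltnS; apply: ltnW.
Qed.

Lemma perm_code s : code_ham s -> perm_eq (map vertex4 s) (enum {: cube_vertex 4}).
Proof.
move=> ps; apply: uniq_full_perm; last first.
  by rewrite size_map (perm_size ps) size_iota card_ffun !card_ord.
rewrite map_inj_in_uniq ?(perm_uniq ps) ?iota_uniq // => m n.
rewrite !(perm_mem ps) !mem_iota => /= m81 n81 e.
have dE (i : 'I_4) : digit m i = digit n i by rewrite -!val_vertex4 e.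
have := (dE (inord 0), dE (inord 1), dE (inord 2), dE (inord 3)).
(* With the powers of 3 as numerals, [lia] recovers a code below 81 from its four digits. *)
rewrite !inordK // /digit expn0 expn1 -[3 ^ 2]/9 -[3 ^ 3]/27.
by case=> [[[]]]; lia.
Qed.

Definition cross_codes1 := [::
  1; 7; 4; 22; 13; 10; 16; 70; 43; 44; 42; 69; 15; 12; 9; 36; 63; 72; 54; 27; 0].
Definition cross_codes2 := [::
  6; 60; 33; 35; 34; 31; 28; 37; 46; 49; 52; 25; 79; 76; 73; 64; 55; 61; 58; 59; 57;
  75; 66; 67; 68; 65; 71; 62; 80; 53; 26; 8; 17; 11; 14; 5; 23; 77; 50; 32; 41; 40;
  39; 30; 48; 45; 51; 78; 24; 21; 18; 19; 20; 74; 47; 38; 29; 56; 2].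
(** Hamilton paths from 0 to 4, 13 and 40, whose base 3 digits are two, three and four ones: one
    path for each distance from 2 to 4. *)
Definition ham_codes2 := [::
  0; 9; 18; 45; 72; 54; 63; 66; 69; 42; 15; 24; 6; 33; 60; 62; 61; 7; 34; 31; 28; 27;
  29; 56; 2; 8; 5; 14; 23; 26; 20; 47; 74; 77; 80; 78; 79; 25; 52; 51; 53; 35; 44; 17;
  71; 68; 65; 11; 38; 36; 37; 43; 40; 39; 41; 32; 50; 49; 48; 75; 21; 12; 3; 30; 57;
  59; 58; 76; 67; 70; 64; 55; 73; 46; 19; 1; 10; 16; 13; 22; 4].
Definition ham_codes3 := [::
  0; 9; 18; 72; 45; 36; 27; 28; 29; 56; 2; 20; 11; 65; 38; 44; 41; 14; 68; 67; 66; 63;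
  69; 42; 15; 17; 16; 7; 25; 26; 24; 78; 51; 52; 53; 47; 50; 23; 77; 74; 80; 71; 62;
  8; 35; 34; 33; 6; 60; 54; 57; 59; 58; 55; 61; 70; 79; 76; 73; 46; 19; 1; 10; 64; 37;
  43; 40; 49; 31; 32; 30; 39; 48; 75; 21; 12; 3; 5; 4; 22; 13].
Definition ham_codes4 := [::
  0; 6; 3; 5; 4; 1; 7; 16; 25; 19; 22; 23; 21; 18; 24; 78; 51; 48; 45; 36; 27; 33; 30;
  31; 32; 41; 50; 53; 47; 38; 29; 56; 2; 20; 11; 14; 17; 26; 8; 35; 62; 71; 80; 74;
  77; 75; 76; 73; 79; 70; 61; 55; 58; 59; 57; 60; 54; 72; 63; 65; 64; 10; 37; 28; 46;
  49; 52; 34; 43; 44; 42; 69; 15; 9; 12; 39; 66; 68; 67; 13; 40].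

Lemma cross_connected4 : cross_connected 4.
Proof.
have d01 : (inord 0 : 'I_4) != inord 1 by rewrite -val_eqE /= !inordK.
apply: (@cross_orbit _ _ _ (vertex4 0) (vertex4 1) (vertex4 2) (vertex4 3) (vertex4 6) d01).
1-5: by apply/ffunP=> -[[|[|[|[|]]]] i4] //; apply: val_inj; rewrite val_vertex4 ffunE -?val_eqE /= ?inordK.
exists (map vertex4 cross_codes1), (map vertex4 cross_codes2); split.
- by apply: (lpath_code (s := cross_codes1)); vm_compute.
- by apply: (lpath_code (s := cross_codes2)); vm_compute.
- by rewrite -map_cons -map_cat; apply: perm_code; vm_compute.
Qed.

Lemma ham_connected4 : ham_connected 4.
Proof.
move=> a b ab; apply: ham_orbit; set r := #|_|.
have r0 : 0 < r.
  rewrite lt0n; apply: contra ab => /eqP/card0_eq h; apply/eqP/ffunP=> k.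
  by have := h k; rewrite !inE => /negbFE/eqP.
have r4 : r <= 4 by rewrite -[4]card_ord max_card.
have -> : [ffun=> ord0] = vertex4 0.
  by apply/ffunP=> -[[|[|[|[|]]]] i4] //; apply: val_inj; rewrite val_vertex4 ffunE.
have tgt n : all (fun i => digit n i == (i < r)) (iota 0 4) ->
    [ffun k : 'I_4 => if k < r then inord 1 else ord0] = vertex4 n.
  move/allP=> h; apply/ffunP=> k; apply: val_inj; rewrite val_vertex4 ffunE.
  have /h/eqP-> : val k \in iota 0 4 by rewrite mem_iota ltn_ord.
  by case: ifP => //= _; rewrite inordK.
move: r0 r4 tgt; case: r => [//|[|[|[|[|//]]]]] _ _ tgt.
(* Distance 1 needs no path of its own: 0 and 1 lie on a line with third vertex 2. *)
- rewrite (tgt 1) //; apply: (adjacent_ham (o := vertex4 2)) => //; first exact: cross_connected4.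
  exact: line_code.
- rewrite (tgt 4) //; exists (map vertex4 ham_codes2); last by apply: perm_code; vm_compute.
  by apply: (lpath_code (s := ham_codes2)); vm_compute.
- rewrite (tgt 13) //; exists (map vertex4 ham_codes3); last by apply: perm_code; vm_compute.
  by apply: (lpath_code (s := ham_codes3)); vm_compute.
- rewrite (tgt 40) //; exists (map vertex4 ham_codes4); last by apply: perm_code; vm_compute.
  by apply: (lpath_code (s := ham_codes4)); vm_compute.
Qed.

(** * Back to loose paths *)

Lemma lpath_nth d (a b x0 : cube_vertex d) s i : lpath a b s -> i.*2.+2 < size s ->
  line (nth x0 s i.*2) (nth x0 s i.*2.+1) (nth x0 s i.*2.+2).
Proof.
move=> h; elim: h i => {a b s} [//|a m b c s l hs IH] [_|i] /=; last exact: IH.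
by have [t ->] := lpath_head hs.
Qed.

(** The edges are distinct because the middle vertex of an edge, the one of odd index, lies in no
    other edge. *)
Lemma lpath_loose d (a b : cube_vertex d) s : lpath a b s -> uniq s ->
  loose_path (size s)./2 s a b.
Proof.
move=> h us; have sz : size s = (2 * (size s)./2).+1.
  by rewrite -{1}(odd_double_half (size s)) (lpath_odd h) mul2n.
set l := _./2 in sz *; split=> //.
- by split; [have [t ->] := lpath_head h | apply: lpath_last h].
- case=> // i /andP[_ il]; apply: line_edge.
  have -> : 2 * i.+1 - 2 = i.*2 by lia.
  have -> : 2 * i.+1 - 1 = i.*2.+1 by lia.
  have -> : 2 * i.+1 = i.*2.+2 by lia.
  by apply: lpath_nth h _; rewrite sz; lia.
- move=> i j /andP[i0 il] /andP[j0 jl] ij; apply/eqP=> e.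
  have : nth a s (2 * i - 1) \in path_edge s a j by rewrite -e !inE eqxx orbT.
  by rewrite !inE !nth_uniq // ?sz; lia.
Qed.

Theorem theorem1p1 (d : nat) : 4 <= d -> loose_hamilton_connected d.
Proof.
(* Both statements are proved together, since Hamilton connectedness in the next dimension uses
   crosses in the old and in the new one. *)
move=> d4; have [_ H] : cross_connected d /\ ham_connected d.
  elim: d d4 => // d IH; rewrite leq_eqVlt => /predU1P[<-|d4].
    by split; [exact: cross_connected4 | exact: ham_connected4].
  have [G H] := IH d4; have d2 : 2 < d by lia.
  have G' := cross_connectedS d2 G; split=> //; exact: ham_connectedS.
move=> a b /H[s hs ps]; exists (size s)./2, s; split.
  by apply: lpath_loose; rewrite // (perm_uniq ps) enum_uniq.
by move=> x; rewrite (perm_mem ps) mem_enum.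
Qed.
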